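(* Let $(\Gamma_n,\mathcal{O})$ be a random oriented cubic graph on $n$ vertices ($n$ even), and let $\mathcal{F}(\Gamma_n,\mathcal{O})$ denote its number of faces. There exist constants $C_1>0$ and $C_2>0$ such that for all sufficiently large even $n$, $$C_1\log(n)\le \boldsymbol{E}(\mathcal{F}(\Gamma_n,\mathcal{O}))\le C_2\sqrt{n}.$$
   Context: Random cubic graph (Bollobas configuration model, $d=3$): let $W=\bigcup_{j=1}^n W_j$ be a disjoint union of $n$ sets with $|W_j|=3$, where $n$ is even, and let $2m=3n$. A configuration $F$ is a partition of $W$ into $m$ pairs, called edges. All configurations are equally likely. The graph $\Gamma_n=\phi(F)$ has vertex set $\{1,\dots,n\}$, and each pair of $F$ with one element in $W_i$ and the other in $W_j$ gives an edge joining $i$ and $j$ (loops and multiple edges are allowed). The elements of $W_j$ are the half-edges (edge-ends) at vertex $j$. Orientation: an orientation $\mathcal{O}$ on a cubic graph $\Gamma$ assigns to each vertex $v$ a cyclic ordering of the three edges (half-edges) emanating from $v$. The random orientation chooses, independently of the graph and independently at each vertex, one of the two cyclic orderings with probability $1/2$ each. Expectation is over both the random configuration and the random orientation. Faces: a left-hand-turn path on $(\Gamma,\mathcal{O})$ is a closed path of directed edges such that at each vertex the path turns left in the orientation $\mathcal{O}$, i.e. having arrived at a vertex $v$ through a half-edge $h$ it leaves $v$ through the half-edge that follows $h$ in the cyclic ordering at $v$. The left-hand-turn paths, considered as cyclic sequences without repeating the period, partition the set of directed edges (each edge having two directions). The faces of $(\Gamma,\mathcal{O})$ are these disjoint left-hand-turn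 paths, and $\mathcal{F}(\Gamma,\mathcal{O})$ is their number. Equivalently, $\mathcal{F}$ is the number of cycles of the permutation of $W$ given by composing the fixed-point-free involution $F$ (swap the two elements of each pair) with the permutation ''next half-edge in the cyclic ordering at the same vertex''. *)

(* Defs.v *)
From HB Require Import structures.
From mathcomp Require Import all_boot all_order all_algebra all_fingroup.
From mathcomp Require Import reals exp.

Set Implicit Arguments.
Unset Strict Implicit.
Unset Printing Implicit Defensive.

Import Order.TTheory GRing.Theory Num.Theory.
Local Open Scope ring_scope.

(* The pair (j, i) is the i-th half-edge at the vertex j, so that W_j is the
   set of the three pairs with first component j. *)
Definition half_edge (n : nat) : finType := ('I_n * 'I_3)%type.

(* The number of pairs is forced: 2m = #|half_edge n| = 3n, and there is no
   configuration when n is odd. *)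
Definition is_configuration (n : nat) (F : {set {set half_edge n}}) : bool :=
  partition F [set: half_edge n] && [forall B in F, #|B| == 2%N].

Definition configuration (n : nat) : finType :=
  {F : {set {set half_edge n}} | is_configuration F}.

(* A cyclic ordering of three objects is given by its successor function,
   which is a permutation with a single cycle. *)
Definition cyclic_order3 : finType := {s : {perm 'I_3} | #|porbits s| == 1%N}.

Definition orientation (n : nat) : finType := {ffun 'I_n -> cyclic_order3}.

Definition mate (n : nat) (F : configuration n) (h : half_edge n) :
    half_edge n :=
  odflt h [pick k in pblock (val F) h :\ h].

Definition next (n : nat) (O : orientation n) (h : half_edge n) :
    half_edge n :=
  (h.1, val (O h.1) h.2).

(* A directed edge is encoded by the half-edge through which it leaves its
   origin; it arrives at its target through the mate of that half-edge. *)
Definition left_turn (n : nat) (F : configuration n) (O : orientation n)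
    (h : half_edge n) : half_edge n :=
  next O (mate F h).

Lemma mate_pblock (n : nat) (F : configuration n) (h : half_edge n) :
  pblock (val F) h = [set h; mate F h] /\ mate F h != h.
Proof.
have /andP[partF /forall_inP cardF] := valP F.
have hF : h \in cover (val F) by rewrite (cover_partition partF) inE.
have hB : h \in pblock (val F) h by rewrite mem_pblock.
have /eqP cB := cardF _ (pblock_mem hF).
have /cards1P[k Ek] : #|pblock (val F) h :\ h| == 1%N.
  by move: cB; rewrite (cardsD1 h) hB add1n => -[->].
have -> : mate F h = k.
  rewrite /mate; case: pickP => [j|/(_ k)] /=; rewrite Ek inE ?eqxx //.
  by move/eqP.
have : k \in pblock (val F) h :\ h by rewrite Ek set11.
by rewrite !inE => /andP[-> _]; rewrite -(setD1K hB) Ek.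
Qed.

Lemma mateK (n : nat) (F : configuration n) : involutive (mate F).
Proof.
move=> h; have [E1 ne1] := mate_pblock F h.
have [E2 ne2] := mate_pblock F (mate F h).
have /andP[/and3P[_ tF _] _] := valP F.
have same : pblock (val F) (mate F h) = pblock (val F) h.
  by apply: same_pblock; rewrite // E1 !inE eqxx orbT.
have : mate F (mate F h) \in pblock (val F) h.
  by rewrite -same E2 !inE eqxx orbT.
by rewrite E1 !inE (negbTE ne2) orbF => /eqP.
Qed.

Lemma left_turn_inj (n : nat) (F : configuration n) (O : orientation n) :
  injective (left_turn F O).
Proof.
apply: inj_comp (can_inj (mateK F)) => -[v i] [w j] /= [<-{w}].
by move/perm_inj=> ->.
Qed.

Definition face_perm (n : nat) (F : configuration n) (O : orientation n) :
    {perm half_edge n} :=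
  perm (@left_turn_inj n F O).

Definition faces (n : nat) (F : configuration n) (O : orientation n) :
    {set {set half_edge n}} :=
  porbits (face_perm F O).

Definition uniform_mean (R : realType) (T : finType) (f : T -> R) : R :=
  (\sum_(x : T) f x) / #|T|%:R.

(* The uniform law on the product type makes the configuration uniform, and
   the cyclic orderings at the vertices independent of it and of each other,
   each of the two orderings having probability 1/2. *)
Definition expected_faces (R : realType) (n : nat) : R :=
  uniform_mean (fun x : configuration n * orientation n =>
    #|faces x.1 x.2|%:R).

(* Main.v *)
(* For a fixed orientation let s be the permutation "next half-edge", which has
   no fixed point, so that the faces are the cycles of s composed with a uniform
   fixed-point-free involution f.  Reveal f one pair at a time: when the mate of
   a half-edge a is revealed to be b, the pair is erased from the cycles of s,
   and a face is completed only if s b = a, s a = b, or both a and b are fixed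
   by s.  As b is uniform among the 2j + 1 other remaining half-edges, choosing
   a not fixed by s closes 2/(2j+1) faces on average.  If every remaining
   half-edge is fixed, each later pair closes exactly one face.  So at least
   1/(2j+1) faces are closed on average at every step, which gives the lower
   bound.  For the upper bound, half the number of fixed points serves as a
   potential that pays for the final stage: it starts at 0 and grows on average
   by at most 1/(2j+1) per step.  Hence the mean lies between H and 3 H, where H
   is the sum of 1/(2j+1) over the 3n/2 steps. *)

Require Import Defs.
From mathcomp Require Import all_boot all_order all_algebra all_fingroup.
From mathcomp Require Import reals exp.
From mathcomp Require Import zify ring lra.

Set Implicit Arguments.
Unset Strict Implicit.
Unset Printing Implicit Defensive.

Import Order.TTheory GRing.Theory Num.Theory.
Local Open Scope nat_scope.

(** * Cutting points out of the cycles of a permutation *)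

Lemma porbits_split_fixed (T : finType) (s : {perm T}) (a : T) :
  #|porbits (s * tperm a (s a))%g| = #|porbits s| + (s a != a).
Proof.
(* Moved to the left of [s], the transposition becomes [tperm (s^-1 a) a]; its two points share a
   cycle, so it splits this cycle unless they coincide. *)
rewrite conjgCV tpermJ permK.
have := porbits_mul_tperm s ((s^-1)%g a) a.
have -> : (s^-1)%g a \in porbit s a.
  by rewrite -porbitV; have := mem_porbit s^-1 1 a; rewrite expg1.
rewrite /= addn0 => ->.
by rewrite -(inj_eq (@perm_inj _ s)) permKV eq_sym.
Qed.

(* The permutation induced by [s] outside [a] and [b] once these two are joined:
   [tperm a b * s] with [a], then [b], cut out of its cycle. *)
Definition glue (T : finType) (s : {perm T}) (a b : T) : {perm T} :=
  let r := (tperm a b * s)%g in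
  let r1 := (r * tperm a (r a))%g in
  (r1 * tperm b (r1 b))%g.

(* The number of the points [a] and [b] that are already alone in their cycle
   when [glue] cuts them out, i.e. of the faces completed by the pair. *)
Definition closed_cycles (T : finType) (s : {perm T}) (a b : T) : nat :=
  (s b == a) + ((s a == b) || (s a == a) && (s b == b)).

Lemma glueE (T : finType) (s : {perm T}) (a b x : T) : x != a -> x != b ->
  glue s a b x = tperm b (tperm a (s b) (s a)) (tperm a (s b) (s x)).
Proof.
by move=> xa xb; rewrite /glue !permM tpermL tpermR (@tpermD _ a b x) // eq_sym.
Qed.

Lemma glueR (T : finType) (s : {perm T}) (a b : T) : glue s a b b = b.
Proof. by rewrite /glue [in LHS]permM tpermR. Qed.

Lemma glueL (T : finType) (s : {perm T}) (a b : T) : a != b ->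
  glue s a b a = a.
Proof.
move=> ab; rewrite /glue [in LHS]permM; set r1 := (_ * tperm a _)%g.
have Ea : r1 a = a by rewrite /r1 [in LHS]permM tpermR.
by rewrite Ea tpermD // 1?eq_sym // -{1}Ea (inj_eq perm_inj).
Qed.

Lemma glue_on (T : finType) (U : {set T}) (s : {perm T}) (a b : T) :
  perm_on U s -> a \in U -> b \in U :\ a ->
  perm_on (U :\: [set a; b]) (glue s a b).
Proof.
move=> sU aU; rewrite 2!inE eq_sym => /andP[ab bU].
apply/subsetP => x; rewrite !inE; apply: contraR.
rewrite negb_and negbK; case: (eqVneq x a) => [-> _|xa] /=.
  by rewrite glueL.
case: (eqVneq x b) => [-> _|xb xU] /=; first by rewrite glueR.
have sx := out_perm sU xU; rewrite glueE // sx.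
have ne y : y \in U -> y != x by apply: contraTneq => ->.
have sU' y : y \in U -> s y \in U by rewrite perm_closed.
rewrite (@tpermD _ a _ x) ?(@tpermD _ b _ x) ?ne ?sU' //.
by case: tpermP => _; rewrite ?sU'.
Qed.

(** The second term tests whether [b] is alone after [a] has been cut out of [tperm a b * s], in the
    form that [glue] produces. *)
Lemma closed_cyclesE (T : finType) (s : {perm T}) (a b : T) : a != b ->
  closed_cycles s a b = (s b == a) + (tperm a (s b) (s a) == b).
Proof.
move=> ab; rewrite /closed_cycles; congr (_ + nat_of_bool _).
case: tpermP => [E|/perm_inj E|/eqP/negbTE sa _].
- by rewrite E eqxx (negbTE ab).
- by rewrite E eqxx in ab.
- by rewrite sa orbF.
Qed.

(** As [f] fixes [a] and [b], the transpositions in [glue] also cut these points out of the cycles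
    of [f * (tperm a b * s)]. Each cut adds one cycle, unless the point was already alone. *)
Lemma porbits_glue (T : finType) (s f : {perm T}) (a b : T) : a != b ->
  f a = a -> f b = b ->
  #|porbits (tperm a b * f * s)%g| + 2 =
  #|porbits (f * glue s a b)%g| + closed_cycles s a b.
Proof.
move=> ab fa fb; rewrite closed_cyclesE //.
have -> : (tperm a b * f = f * tperm a b)%g.
  by rewrite [RHS]conjgCV tpermJ -{2}fa -{2}fb !permK.
rewrite /glue; set r := (tperm a b * s)%g; rewrite -mulgA -/r.
set r1 := (r * _)%g.
have ra : r a = s b by rewrite /r permM tpermL.
have r1b : r1 b = tperm a (s b) (s a) by rewrite /r1 ra !permM tpermR.
have Ea : (f * r)%g a = r a by rewrite permM fa.
have Eb : (f * r1)%g b = r1 b by rewrite permM fb.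
have := porbits_split_fixed (f * r1)%g b; rewrite Eb -mulgA => ->.
have := porbits_split_fixed (f * r)%g a; rewrite Ea -mulgA -/r1 => ->.
by rewrite ra r1b -!addnA; do 2!case: eqP.
Qed.

(** * Matchings of a finite set, as involutions moving exactly its points *)

Definition matching (T : finType) (U : {set T}) : {set {perm T}} :=
  [set f : {perm T} | [forall x, (f (f x) == x) && ((f x != x) == (x \in U))]].

Lemma matchingP (T : finType) (U : {set T}) (f : {perm T}) :
  reflect (involutive f /\ forall x, (f x != x) = (x \in U)) (f \in matching U).
Proof.
rewrite inE; apply: (iffP forallP) => [H|[fK fU] x]; last first.
  by rewrite fK fU !eqxx.
by split=> x; have /andP[/eqP ? /eqP] := H x.
Qed.

Lemma matching_cons (T : finType) (U : {set T}) (a b : T) (f : {perm T}) :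
  a \in U -> b \in U -> a != b ->
  ((tperm a b * f)%g \in matching U) && ((tperm a b * f)%g a == b) =
  (f \in matching (U :\: [set a; b])).
Proof.
move=> aU bU ab; apply/andP/idP.
- case=> /matchingP[gK gU]; rewrite permM tpermL => /eqP fb.
  have fa : f a = a by have := gK a; rewrite !permM tpermL fb tpermR.
  have E x : x != a -> x != b -> (tperm a b * f)%g x = f x.
    by move=> xa xb; rewrite permM tpermD // eq_sym.
  have fx x : x != a -> x != b -> f x != a /\ f x != b.
    by move=> xa xb; split; rewrite -1?fa -1?fb (inj_eq perm_inj).
  apply/matchingP; split=> x.
    case: (eqVneq x a) => [->|xa]; first by rewrite !fa.
    case: (eqVneq x b) => [->|xb]; first by rewrite !fb.
    by have [ya yb] := fx x xa xb; rewrite -(E x) // -E ?gK // E.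
  rewrite !inE; case: (eqVneq x a) => [->|xa]; first by rewrite fa eqxx.
  case: (eqVneq x b) => [->|xb]; first by rewrite fb eqxx.
  by rewrite -E // gU.
- move=> /matchingP[fK fU].
  have /eqP fa : f a == a by apply: negbFE; rewrite fU !inE eqxx.
  have /eqP fb : f b == b by apply: negbFE; rewrite fU !inE eqxx orbT.
  rewrite permM tpermL fb eqxx; split=> //; apply/matchingP.
  have fx x : x != a -> x != b -> f x != a /\ f x != b.
    by move=> xa xb; split; rewrite -1?fa -1?fb (inj_eq perm_inj).
  split=> x; rewrite !permM.
    case: (eqVneq x a) => [->|xa]; first by rewrite tpermL fb tpermR.
    case: (eqVneq x b) => [->|xb]; first by rewrite tpermR fa tpermL.
    have [ya yb] := fx x xa xb.
    by rewrite (@tpermD _ _ _ x) ?tpermD ?fK // eq_sym.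
  case: (eqVneq x a) => [->|xa]; first by rewrite tpermL fb aU eq_sym.
  case: (eqVneq x b) => [->|xb]; first by rewrite tpermR fa bU.
  by rewrite tpermD 1?eq_sym // eq_sym fU !inE negb_or xa xb.
Qed.

(** The matchings are classified by the mate [b] of [a]; left multiplication by [tperm a b] erases
    this pair. *)
Lemma sum_matching (T : finType) (U : {set T}) (a : T) (g : {perm T} -> nat) :
  a \in U ->
  \sum_(f in matching U) g f =
  \sum_(b in U :\ a) \sum_(f in matching (U :\: [set a; b]))
    g (tperm a b * f)%g.
Proof.
move=> aU.
rewrite (partition_big (fun f : {perm T} => f a) (mem (U :\ a))) /=; last first.
  move=> f /matchingP[fK fU].
  by rewrite !inE fU aU -fU fK eq_sym fU.
apply: eq_bigr => b; rewrite !inE => /andP[ba bU].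
rewrite (reindex_inj (mulgI (tperm a b))); apply: eq_bigl => f.
by rewrite matching_cons // eq_sym.
Qed.

Lemma matching0 (T : finType) : matching (set0 : {set T}) = [set 1%g].
Proof.
apply/setP => f; apply/idP/set1P => [/matchingP[_ fU]|->].
  by apply/permP => x; rewrite perm1; apply/eqP; rewrite -[_ == _]negbK fU inE.
by apply/matchingP; split=> x; rewrite !perm1 // eqxx inE.
Qed.

(** The double factorial [(2j-1)!!]. *)
Definition odd_fact (j : nat) : nat := \prod_(i < j) i.*2.+1.

Lemma odd_factS (j : nat) : odd_fact j.+1 = odd_fact j * j.*2.+1.
Proof. exact: big_ord_recr. Qed.

Lemma card_remove_pair (T : finType) (U : {set T}) (a b : T) (j : nat) :
  #|U| = j.+1.*2 -> a \in U -> b \in U :\ a -> #|U :\: [set a; b]| = j.*2.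
Proof.
move=> cU aU bU; rewrite -setDDl.
by move: cU; rewrite (cardsD1 a) aU (cardsD1 b) bU; lia.
Qed.

Lemma card_remove (T : finType) (U : {set T}) (a : T) (j : nat) :
  #|U| = j.+1.*2 -> a \in U -> #|U :\ a| = j.*2.+1.
Proof. by move=> cU aU; move: cU; rewrite (cardsD1 a) aU; lia. Qed.

Lemma card_matching (T : finType) (U : {set T}) (j : nat) : #|U| = j.*2 ->
  #|matching U| = odd_fact j.
Proof.
elim: j U => [|j IHj] U cU.
  by move/eqP: cU; rewrite cards_eq0 => /eqP->; rewrite matching0 cards1
    /odd_fact big_ord0.
have /card_gt0P[a aU] : 0 < #|U| by rewrite cU.
rewrite -sum1_card (sum_matching _ aU).
under eq_bigr => b bU do
  rewrite sum1_card (IHj _ (card_remove_pair cU aU bU)).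
by rewrite sum_nat_const (card_remove cU aU) odd_factS mulnC.
Qed.

(** * Cycle counts summed over all matchings *)

Definition fixed_points (T : finType) (U : {set T}) (s : {perm T}) : {set T} :=
  [set x in U | s x == x].

Definition total_cycles (T : finType) (U : {set T}) (s : {perm T}) : nat :=
  \sum_(f in matching U) #|porbits (f * s)%g|.

(** This is [porbits_glue] summed over all matchings; the 2 per matching accounts for [a] and [b],
    which [glue] leaves as separate cycles. *)
Lemma total_cycles_rec (T : finType) (U : {set T}) (s : {perm T}) (a : T)
    (j : nat) :
  #|U| = j.+1.*2 -> a \in U ->
  total_cycles U s + odd_fact j.+1 * 2 =
  \sum_(b in U :\ a) total_cycles (U :\: [set a; b]) (glue s a b) +
  odd_fact j * \sum_(b in U :\ a) closed_cycles s a b.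
Proof.
move=> cU aU; rewrite -(card_matching cU) -sum_nat_const /total_cycles.
rewrite -big_split /= (sum_matching _ aU) big_distrr -big_split /=.
apply: eq_bigr => b bU; have cU' := card_remove_pair cU aU bU.
rewrite -(card_matching cU') -sum_nat_const -big_split /=.
have ab : a != b by move: bU; rewrite !inE eq_sym => /andP[].
apply: eq_bigr => f /matchingP[_ fU]; apply: porbits_glue => //;
  by apply/eqP/negbFE; rewrite fU !inE eqxx ?orbT.
Qed.

Lemma sum_pred1 (T : finType) (A : {set T}) (c : T) :
  \sum_(b in A) (b == c) = (c \in A).
Proof.
case: (boolP (c \in A)) => cA.
  by rewrite (bigD1 c) //= eqxx big1 // => i /andP[_ /negbTE->].
by rewrite big1 // => i iA; case: eqP iA cA => // -> ->.
Qed.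

(** Only the mates [s a] and [s^-1 a] of [a] close a cycle; if they coincide, that mate closes
    two. *)
Lemma sum_closed_cycles (T : finType) (U : {set T}) (s : {perm T}) (a : T) :
  perm_on U s -> a \in U -> s a != a ->
  \sum_(b in U :\ a) closed_cycles s a b = 2.
Proof.
move=> sU aU sa.
rewrite (eq_bigr (fun b => (b == (s^-1)%g a) + (b == s a))).
  rewrite big_split /= !sum_pred1 !inE !perm_closed ?perm_onV // aU sa.
  by rewrite -(inj_eq (@perm_inj _ s)) permKV eq_sym sa.
move=> b _; rewrite /closed_cycles (negbTE sa) orbF; congr (_ + _).
  by rewrite -[in RHS](inj_eq (@perm_inj _ s)) permKV.
by rewrite eq_sym.
Qed.

(** A new fixed point is [s a] with [s (s a) = b], or [s b] with [s (s b) = a], or [s a] when [b] is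
    itself fixed. In the last case the loss of the fixed point [b] pays for it. *)
Lemma fixed_glue (T : finType) (U : {set T}) (s : {perm T}) (a b : T) :
  s a != a -> b \in U :\ a ->
  #|fixed_points (U :\: [set a; b]) (glue s a b)| <=
  #|fixed_points U s| + (b == s (s a)) + (b == (s^-1)%g ((s^-1)%g a)).
Proof.
move=> sa; rewrite !inE => /andP[ba bU].
have -> : (b == (s^-1)%g ((s^-1)%g a)) = (s (s b) == a).
  rewrite -(inj_eq (@perm_inj _ s)) permKV.
  by rewrite -(inj_eq (@perm_inj _ s)) permKV.
have Ea : tperm a (s b) (s a) = s a.
  by rewrite tpermD ?(inj_eq perm_inj) // eq_sym.
have key x : x \in fixed_points (U :\: [set a; b]) (glue s a b) ->
    [\/ x \in fixed_points U s :\ b, x = s a /\ s b = b,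
        x = s b /\ s (s b) = a | x = s a /\ s (s a) = b].
  rewrite !inE negb_or => /andP[/andP[/andP[xa xb] xU]].
  rewrite glueE // Ea.
  case: (tpermP a (s b) (s x)) => [sx|/perm_inj/eqP|_ _]; last 2 first.
  - by rewrite (negbTE xb).
  - case: tpermP => [sx /eqP E|/perm_inj/eqP|_ _ ->].
    + by constructor 4; rewrite E sx.
    + by rewrite (negbTE xa).
    + by constructor 1; rewrite xb xU.
  case: tpermP => [sb /eqP E|/perm_inj/eqP|_ _ /eqP E].
  - by constructor 2.
  - by rewrite (negbTE ba).
  - by constructor 3; rewrite E.
case: (eqVneq (s b) b) => sb.
  have bF : b \in fixed_points U s by rewrite inE bU sb eqxx.
  have sub : fixed_points (U :\: [set a; b]) (glue s a b) \subset
      s a |: (fixed_points U s :\ b).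
    apply/subsetP => x /key[xF|[-> _]|[-> E]|[-> E]]; rewrite in_setU1 ?eqxx //.
    - by rewrite xF orbT.
    - by move: ba; rewrite -E !sb eqxx.
  apply: leq_trans (subset_leq_card sub) _;
  rewrite cardsU1 (cardsD1 b (fixed_points U s)) bF.
  by case: (_ \notin _); lia.
set P := (if s (s a) == b then [set s a] else set0).
set Q := (if s (s b) == a then [set s b] else set0).
have sub : fixed_points (U :\: [set a; b]) (glue s a b) \subset
      (fixed_points U s :|: P) :|: Q.
  apply/subsetP => x /key[|[_ E]|[-> E]|[-> E]]; rewrite !in_setU.
  - by rewrite in_setD1 => /andP[_ ->].
  - by rewrite E eqxx in sb.
  - by rewrite /Q E eqxx set11 !orbT.
  - by rewrite /P E eqxx set11 orbT.
apply: leq_trans (subset_leq_card sub) _.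
apply: leq_trans (leq_card_setU _ _) _; apply: leq_add.
  apply: leq_trans (leq_card_setU _ _) _; rewrite leq_add2l /P eq_sym.
  by case: eqP; rewrite ?cards1 ?cards0.
by rewrite /Q; case: eqP; rewrite ?cards1 ?cards0.
Qed.

Lemma sum_fixed_glue (T : finType) (U : {set T}) (s : {perm T}) (a : T)
    (j : nat) :
  #|U| = j.+1.*2 -> a \in U -> s a != a ->
  \sum_(b in U :\ a) #|fixed_points (U :\: [set a; b]) (glue s a b)| <=
  j.*2.+1 * #|fixed_points U s| + 2.
Proof.
move=> cU aU sa; rewrite -(card_remove cU aU) -sum_nat_const.
apply: leq_trans.
  by apply: leq_sum => b bU; apply: fixed_glue bU.
rewrite !big_split /= !sum_pred1 -addnA leq_add2l.
by case: (_ \in _); case: (_ \in _).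
Qed.

Lemma porbits1 (T : finType) : #|porbits (1%g : {perm T})| = #|T|.
Proof.
rewrite /porbits card_imset // => x y /eqP.
by rewrite eq_porbit_mem => /porbitP[i ->]; rewrite expg1n perm1.
Qed.

(** The sum of [1/(2i+1)] over [i < j], multiplied by [odd_fact j] so that the induction stays in
    [nat]. *)
Fixpoint odd_harm_num (j : nat) : nat :=
  if j is i.+1 then i.*2.+1 * odd_harm_num i + odd_fact i else 0.

(* The points outside [U] are fixed by both [f] and [s], and each of them counts
   as one cycle: this is the [#|~: U|] term. *)
Lemma total_cycles_bounds (T : finType) (j : nat) (U : {set T})
    (s : {perm T}) :
  perm_on U s -> #|U| = j.*2 ->
  odd_harm_num j + odd_fact j * #|~: U| <= total_cycles U s /\
  2 * total_cycles U s <=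
    6 * odd_harm_num j + odd_fact j * (#|fixed_points U s| + 2 * #|~: U|).
Proof.
elim: j U s => [|j IHj] U s sU cU.
  move/eqP: cU; rewrite cards_eq0 => /eqP U0.
  have s1 : s = 1%g by apply: perm_on_id sU _; rewrite U0 cards0.
  have := cardsC U; rewrite U0 cards0 add0n => ->.
  rewrite /total_cycles matching0 big_set1 s1 mul1g porbits1.
  by rewrite /odd_fact big_ord0; split=> /=; lia.
have [a aU choice] : exists2 a, a \in U &
    s a != a \/ forall x, x \in U -> s x = x.
  case: (pickP [pred x in U | s x != x]) => [a /andP[]|H].
    by exists a => //; left.
  have /card_gt0P[a aU] : 0 < #|U| by rewrite cU.
  exists a => //; right=> x xU; apply/eqP.
  by have := H x; rewrite /= xU => /negbFE.
have cU' := card_remove cU aU.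
have IH b (bU : b \in U :\ a) :=
  IHj _ _ (glue_on sU aU bU) (card_remove_pair cU aU bU).
have cC b : b \in U :\ a -> #|~: (U :\: [set a; b])| = #|~: U| + 2.
  move=> bU; have := cardsC U; rewrite -(cardsC (U :\: [set a; b])) cU.
  by rewrite (card_remove_pair cU aU bU); lia.
set q := #|~: U| in cC *; set F := fun b => U :\: [set a; b].
have lower : j.*2.+1 * (odd_harm_num j + odd_fact j * (q + 2)) <=
    \sum_(b in U :\ a) total_cycles (F b) (glue s a b).
  rewrite -cU' -sum_nat_const; apply: leq_sum => b bU.
  by have [] := IH b bU; rewrite cC.
have upper : 2 * \sum_(b in U :\ a) total_cycles (F b) (glue s a b) <=
    j.*2.+1 * (6 * odd_harm_num j + odd_fact j * (2 * (q + 2))) +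
    odd_fact j * \sum_(b in U :\ a) #|fixed_points (F b) (glue s a b)|.
  rewrite -cU' -sum_nat_const !big_distrr -big_split; apply: leq_sum => b bU.
  have [_] := IH b bU; rewrite cC // -/(F b) mulnDr => H.
  by apply: leq_trans H _; rewrite /=; lia.
have := total_cycles_rec s cU aU; rewrite odd_factS /= -/F.
(* For [a] not fixed, the constant 6 is spent exactly: 4 on the two closed cycles, counted twice,
   and 2 on the new fixed points. *)
case: choice => [sa|sid].
  have := sum_fixed_glue cU aU sa; rewrite sum_closed_cycles // -/F.
  move: upper lower; rewrite -/F.
  move: (\sum_(b in _) _) (\sum_(b in _) _) => X Y.
  nia.
(* Now every mate of [a] closes one cycle, counted twice in the upper bound; the two fixed points
   that disappear pay for it. *)
have -> : fixed_points U s = U.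
  by apply/setP => x; rewrite inE andb_idr // => /sid/eqP.
have -> : \sum_(b in U :\ a) closed_cycles s a b = j.*2.+1.
  rewrite -cU' -sum1_card; apply: eq_bigr => b.
  rewrite !inE => /andP[/negbTE ba bU].
  by rewrite /closed_cycles !sid // ba !eqxx orbT.
have : \sum_(b in U :\ a) #|fixed_points (F b) (glue s a b)| <= j.*2.+1 * j.*2.
  rewrite -cU' -sum_nat_const; apply: leq_sum => b bU.
  rewrite -(card_remove_pair cU aU bU); apply: subset_leq_card.
  by apply/subsetP => x /setIdP[].
rewrite cU; move: upper lower; rewrite -/F.
move: (\sum_(b in _) _) (\sum_(b in _) _) => X Y.
nia.
Qed.

(** * Configurations as matchings of the half-edges *)

Definition mate_perm (n : nat) (F : configuration n) : {perm half_edge n} :=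
  perm (can_inj (mateK F)).

Lemma configurationE (n : nat) (F : configuration n) :
  val F = [set [set h; mate F h] | h in [set: half_edge n]].
Proof.
have /andP[partF _] := valP F; have /and3P[_ tF F0] := partF.
apply/setP => B; apply/idP/imsetP => [BF|[h _ ->]]; last first.
  have [<- _] := mate_pblock F h.
  by rewrite pblock_mem // (cover_partition partF) inE.
have [B0|[h hB]] := set_0Vmem B; first by rewrite -B0 BF in F0.
exists h; first by rewrite inE.
by have [<- _] := mate_pblock F h; rewrite (def_pblock tF BF hB).
Qed.

Lemma mate_perm_inj (n : nat) : injective (@mate_perm n).
Proof.
move=> F G /permP E; apply: val_inj.
have {}E h : mate F h = mate G h by have := E h; rewrite !permE.
rewrite /= (configurationE F) (configurationE G).
by apply: eq_imset => h; rewrite E.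
Qed.

Lemma matching_configuration (n : nat) (f : {perm half_edge n}) :
  f \in matching setT -> exists F : configuration n, f = mate_perm F.
Proof.
move=> /matchingP[fK fT].
pose P := [set [set h; f h] | h in [set: half_edge n]].
have E h k : k \in [set h; f h] -> [set h; f h] = [set k; f k].
  by case/set2P => -> //; rewrite fK setUC.
have tP : trivIset P.
  apply/trivIsetP => _ _ /imsetP[h _ ->] /imsetP[k _ ->].
  apply: contraR => /pred0Pn[l /= /andP[lh lk]].
  by rewrite (E _ _ lh) (E _ _ lk).
have confP : is_configuration P.
  apply/andP; split; last first.
    apply/forall_inP => _ /imsetP[h _ ->].
    by rewrite cards2 (eq_sym h) fT inE.
  apply/and3P; split=> //.
    apply/eqP/setP => h; rewrite inE; apply/bigcupP.
    exists [set h; f h]; last by rewrite set21.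
    by apply: imset_f; rewrite inE.
  apply/imsetP => -[h _ E0].
  by have := set21 h (f h); rewrite -E0 inE.
exists (Sub P confP); apply/permP => h; rewrite permE.
have [Eh _] := mate_pblock (Sub P confP) h.
have hB : [set h; f h] \in P by apply: imset_f; rewrite inE.
have := set22 h (f h); rewrite -(def_pblock tP hB (set21 _ _)) Eh.
case/set2P => // Efh; by have := fT h; rewrite Efh eqxx inE.
Qed.

Lemma matchingT (n : nat) :
  matching [set: half_edge n] = [set mate_perm F | F in [set: configuration n]].
Proof.
apply/setP => f; apply/idP/imsetP => [/matching_configuration[F ->]|[F _ ->]].
  by exists F; rewrite ?inE.
apply/matchingP; split=> h; rewrite !permE ?mateK // inE.
by case: (mate_pblock F h).
Qed.

(** * Faces summed over configurations and orientations *)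

Lemma next_inj (n : nat) (O : orientation n) : injective (@Defs.next n O).
Proof. by case=> v i [w j] /= [<-{w}] /perm_inj->. Qed.

Definition next_perm (n : nat) (O : orientation n) : {perm half_edge n} :=
  perm (@next_inj n O).

Lemma sum_faces (n : nat) (O : orientation n) :
  \sum_(F : configuration n) #|faces F O| =
  total_cycles [set: half_edge n] (next_perm O).
Proof.
rewrite /total_cycles matchingT big_imset /=; last first.
  by move=> F G _ _; apply: mate_perm_inj.
apply: eq_big => [F|F _]; first by rewrite inE.
congr #|porbits _|; apply/permP => h.
by rewrite permM !permE.
Qed.

(** All of ['I_3] is one orbit of a cyclic order, so a fixed index would equal both [ord0] and
    [ord_max]. *)
Lemma fixed_next_perm (n : nat) (O : orientation n) :
  fixed_points [set: half_edge n] (next_perm O) = set0.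
Proof.
apply/setP => -[v i]; rewrite !inE permE; apply/negP => /eqP[Ei].
have /cards1P[B EB] := valP (O v).
have orb k : porbit (val (O v)) k = B.
  by apply/set1P; rewrite -EB; apply: imset_f; rewrite inE.
have Bi k : k = i.
  have : k \in porbit (val (O v)) i by rewrite orb -(orb k) porbit_id.
  case/porbitP => t ->; elim: t => [|t IHt]; first by rewrite perm1.
  by rewrite expgSr permM IHt.
by have := etrans (Bi ord0) (esym (Bi ord_max)).
Qed.

Lemma card_orientation_gt0 (n : nat) : 0 < #|{: orientation n}|.
Proof.
rewrite card_ffun expn_gt0; apply/orP; left.
pose s : {perm 'I_3} := perm (@ordS_inj 3).
have s1 : #|porbits s| == 1.
  apply/cards1P; exists (porbit s ord0); apply/setP => B.
  rewrite inE; apply/imsetP/eqP => [[i _ ->]|->]; last by exists ord0.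
  apply/eqP; rewrite eq_porbit_mem.
  apply/porbitP; exists (val i); apply: val_inj.
  by case: i => -[|[|[|//]]] ? ; rewrite ?expgS ?expg0 ?permM ?perm1 ?permE.
by apply/card_gt0P; exists (Sub s s1).
Qed.

Lemma sum_faces_bounds (n m : nat) : 3 * n = m.*2 ->
  let S := \sum_(x : configuration n * orientation n) #|faces x.1 x.2| in
  let k := #|{: orientation n}| in
  #|{: configuration n * orientation n}| = odd_fact m * k /\
  odd_harm_num m * k <= S <= 3 * (odd_harm_num m * k).
Proof.
move=> nm S k.
have cT : #|[set: half_edge n]| = m.*2.
  by rewrite cardsT card_prod !card_ord mulnC.
split.
  rewrite card_prod -(card_matching cT) matchingT card_imset ?cardsT //.
  exact: mate_perm_inj.
have -> : S = \sum_(O : orientation n)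
    total_cycles [set: half_edge n] (next_perm O).
  rewrite /S; under [RHS]eq_bigr do rewrite -sum_faces.
  by rewrite exchange_big pair_big.
(* The bounds hold for each orientation separately: there are no fixed points and the complement is
   empty, so both correction terms vanish. *)
have bnd (O : orientation n) : odd_harm_num m <=
    total_cycles [set: half_edge n] (next_perm O) <= 3 * odd_harm_num m.
  have sT : perm_on [set: half_edge n] (next_perm O).
    by apply/subsetP => h; rewrite inE.
  have [] := total_cycles_bounds sT cT.
  by rewrite fixed_next_perm setCT cards0; lia.
rewrite -!(mulnC k) mulnCA -!sum_nat_const /=.
by apply/andP; split; apply: leq_sum => O _; have /andP[] := bnd O.
Qed.

(** * Estimates of the odd harmonic sum *)

Local Open Scope ring_scope.

Lemma odd_fact_gt0 (j : nat) : (0 < odd_fact j)%N.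
Proof. exact: prodn_gt0. Qed.

Lemma odd_harm_numE (R : realType) (m : nat) :
  (odd_harm_num m)%:R = (odd_fact m)%:R * \sum_(i < m) (i.*2.+1%:R)^-1 :> R.
Proof.
elim: m => [|m IHm]; first by rewrite big_ord0 mulr0.
rewrite big_ord_recr odd_factS /= natrD !natrM IHm; field.
by rewrite nat1r pnatr_eq0.
Qed.

(** The increment [ln (1 + 1/(m+1))] is at most [1/(m+1)], hence at most [2/(2m+1)]. *)
Lemma ln_le_odd_harmonic (R : realType) (m : nat) :
  ln m.+1%:R <= 2 * \sum_(i < m) (i.*2.+1%:R)^-1 :> R.
Proof.
elim: m => [|m IHm]; first by rewrite big_ord0 mulr0 ln1.
rewrite big_ord_recr mulrDr /=.
have m0 : (0 : R) < m.+1%:R by rewrite ltr0n.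
have -> : m.+2%:R = m.+1%:R * (1 + m.+1%:R^-1) :> R.
  by rewrite mulrDr mulr1 divff ?gt_eqF // -[LHS]natr1.
have i0 : (0 : R) < m.+1%:R^-1 by rewrite invr_gt0.
rewrite lnM ?posrE ?addr_gt0 //; apply: lerD => //.
apply: le_trans (le_ln1Dx _) _; first by apply: lt_trans i0; rewrite ltrN10.
rewrite -[X in X <= _]invrK -[2]invrK -invfM.
rewrite lef_pV2 ?posrE ?mulr_gt0 ?invr_gt0 ?ltr0n //.
rewrite invrK mulrC ler_pdivrMr // -natrM ler_nat; lia.
Qed.

(** Telescoping: [1/(2m+1)] is at most twice the increment of the square root from [m] to [m+1]. *)
Lemma odd_harmonic_le_sqrt (R : realType) (m : nat) :
  \sum_(i < m) (i.*2.+1%:R)^-1 <= 2 * Num.sqrt (m%:R) :> R.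
Proof.
elim: m => [|m IHm]; first by rewrite big_ord0 mulr_ge0 ?sqrtr_ge0.
rewrite big_ord_recr /=; apply: le_trans (lerD IHm (lexx _)) _.
rewrite -lerBrDl -mulrBr.
have k0 : (0 : R) < m.*2.+1%:R by rewrite ltr0n.
rewrite -[X in X <= _]mul1r ler_pdivrMr //.
have Ex : Num.sqrt m.+1%:R ^+ 2 = m.+1%:R :> R by rewrite sqr_sqrtr ?ler0n.
have Ey : Num.sqrt m%:R ^+ 2 = m%:R :> R by rewrite sqr_sqrtr ?ler0n.
have y0 : 0 <= Num.sqrt m%:R :> R := sqrtr_ge0 _.
have x1 : 1 <= Num.sqrt m.+1%:R :> R.
  by rewrite -[X in X <= _]sqrtr1 ler_wsqrtr // ler1n.
have yx : Num.sqrt m%:R <= Num.sqrt m.+1%:R :> R.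
  by rewrite ler_wsqrtr // ler_nat.
have Em : m.*2.+1%:R = 2 * m%:R + 1 :> R by rewrite -natr1 -mul2n natrM.
rewrite Em; rewrite -[in RHS]natr1 in Ex.
move: (m%:R) (Num.sqrt m%:R) (Num.sqrt m.+1%:R)
  Ex Ey y0 x1 yx => M y x Ex Ey y0 x1 yx.
have x_le : x <= 2 * M + 1 by nra.
(* Here [(x - y) * (x + y) = 1] and [x + y <= 2 * x]. *)
have xy1 : 1 <= 2 * (x - y) * x by nra.
by apply: le_trans xy1 _; rewrite ler_wpM2l // mulr_ge0 // subr_ge0.
Qed.

(** * Bounds on the expected number of faces *)

Theorem theorem1p2 (R : realType) :
  exists C1 C2 : R, 0 < C1 /\ 0 < C2 /\
    exists N : nat, forall n : nat, (N <= n)%N -> ~~ odd n ->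
      C1 * ln (n%:R : R) <= expected_faces R n /\
      expected_faces R n <= C2 * Num.sqrt (n%:R : R).
Proof.
(* With [m = 3n/2], the mean lies between [H] and [3 H]. The constant 1/2 comes from
   [ln (m+1) <= 2 H], and 12 is 3 * 2 * 2, from [H <= 2 sqrt m] and [m <= 4n]. *)
exists 2^-1, 12; split; first by rewrite invr_gt0.
split=> //; exists 1%N => n n1 n_even.
have [m nm] : exists m, (3 * n)%N = m.*2.
  by exists (3 * n)./2; rewrite even_halfK // oddM negb_and n_even orbT.
have [cardE /andP[lo hi]] := sum_faces_bounds nm.
have k0 : (0 : R) < #|{: orientation n}|%:R.
  by rewrite ltr0n card_orientation_gt0.
have f0 : (0 : R) < (odd_fact m)%:R by rewrite ltr0n odd_fact_gt0.
rewrite /expected_faces /uniform_mean cardE natrM -natr_sum.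
rewrite ler_pdivlMr ?mulr_gt0 // ler_pdivrMr ?mulr_gt0 //.
move: lo hi; rewrite -!(ler_nat R) !natrM odd_harm_numE => lo hi.
split.
  apply: le_trans lo; rewrite mulrA ler_pM2r // mulrC ler_pM2l //.
  rewrite mulrC ler_pdivrMr // mulrC; apply: le_trans (ln_le_odd_harmonic _ m).
  by rewrite ler_ln ?posrE ?ltr0n // ler_nat; lia.
apply: le_trans hi _; rewrite !mulrA ler_pM2r // mulrAC ler_pM2r //.
have := odd_harmonic_le_sqrt R m.
have : Num.sqrt m%:R <= Num.sqrt (2 ^+ 2 * n%:R) :> R.
  by rewrite ler_wsqrtr // -natrX -natrM ler_nat; lia.
rewrite sqrtrM ?exprn_ge0 // sqrtr_sqr ger0_norm //.
move: (\sum_(i < m) _) (Num.sqrt m%:R) (Num.sqrt n%:R) => x y z; lra.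
Qed.
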